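(* Let $n\ge 1$. Consider repositories with $n$ packages in which no defects or conflicts exist ($D=\emptyset$, $C=\emptyset$), while the number of known dependencies is not bounded. Any non-adaptive algorithm that solves Full Learning must make at least $n-1$ queries (in the worst case over its inputs). This holds even when the repositories are restricted to have at most one unknown dependency ($|U|\le 1$).
   Context: A repository consists of a finite set $P$ of $n$ packages, a set $K\subseteq P\times P$ of known dependencies, a set $U\subseteq P\times P$ of unknown dependencies, a set $C$ of unknown conflicts (unordered pairs of distinct packages), and a set $D\subseteq P$ of defects. A dependency $(q,p)\in K\cup U$ means that $q$ depends on $p$. The digraph $(P,K)$ is acyclic ($U$ may create cycles). An installation is a subset $I\subseteq P$; it is successful iff (i) $I\cap D=\emptyset$, (ii) for every $(q,p)\in K\cup U$, $q\in I$ implies $p\in I$, and (iii) no $\{p,q\}\in C$ satisfies $p,q\in I$. An algorithm is given $P$, $K$ and the stated bounds. A query is an installation $I\subseteq P$; the oracle answers whether $I$ is successful. A non-adaptive algorithm fixes its whole set of queries from its input alone, then computes its output from the answers. Local computation is free; the cost is the number of queries. Full Learning: output the mixed graph describing the repository: its vertices are the strongly connected components of the packages with respect to all dependencies (with defective ones marked), with all conflicts and all dependencies between them, the dependencies being required only up to transitive closure. In the present setting (no defects, no conflicts) this amounts to determining the transitive closure (reachability relation) of the digraph $(P,K\cup U)$. *)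

(* Defs.v *)
From mathcomp Require Import all_boot.

Set Implicit Arguments.
Unset Strict Implicit.
Unset Printing Implicit Defensive.

(* (q, p) \in E means that q depends on p. *)
Definition edge_rel (T : finType) (E : {set T * T}) : rel T :=
  fun x y => (x, y) \in E.

(* [cycle e c] asks for a closed walk, with repetitions allowed and loops
   included; it holds trivially of the empty sequence. *)
Definition acyclic (T : finType) (E : {set T * T}) : Prop :=
  forall c : seq T, cycle (edge_rel E) c -> c = [::].

Record repository (P : finType) := Repository {
  known : {set P * P};
  unknown : {set P * P};
  conflicts : {set {set P}};
  defects : {set P};
  known_acyclic : acyclic known;
  conflicts_pairs : forall c, c \in conflicts -> #|c| = 2
}.

Section Repository.
Variables (P : finType) (r : repository P).

Definition dependencies : {set P * P} := known r :|: unknown r.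

Definition successful (I : {set P}) : bool :=
  [&& I :&: defects r == set0,
      [forall e in dependencies, (e.1 \in I) ==> (e.2 \in I)]
    & [forall c in conflicts r, ~~ (c \subset I)]].

Definition reaches : rel P := connect (edge_rel dependencies).

Definition scc (p : P) : {set P} := [set q | reaches p q && reaches q p].

Definition sccs : {set {set P}} := [set scc p | p : P].

Definition scc_dependencies : {set {set P} * {set P}} :=
  [set (scc e.1, scc e.2) | e in dependencies].

(* A conflict is the set of its endpoints; a conflict between two packages of
   the same component yields a singleton, i.e. a loop. *)
Definition scc_conflicts : {set {set {set P}}} :=
  [set [set scc p | p in c] | c : {set P} in conflicts r].

End Repository.

Record mixed_graph (P : finType) := MixedGraph {
  vertices : {set {set P}};
  marked : {set {set P}};
  edges : {set {set {set P}}};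
  arcs : {set {set P} * {set P}}
}.

(* Arcs are compared through [connect], the reflexive-transitive closure, so
   that any graph with the right reachability relation is accepted. *)
Definition describes (P : finType) (G : mixed_graph P) (r : repository P) :
    Prop :=
  [/\ vertices G = sccs r,
      marked G = [set A in sccs r | A :&: defects r != set0],
      edges G = scc_conflicts r
    & connect (edge_rel (arcs G)) =2 connect (edge_rel (scc_dependencies r))].

(* [output K S] is what is computed on input K when S is the set of those
   queries in [queries K] that the oracle declares successful; since
   [queries K] is known, S carries all the answers.  The bounds given to the
   algorithm are fixed, hence not an argument. *)
Record nonadaptive_algorithm (P : finType) := NonadaptiveAlgorithm {
  queries : {set P * P} -> {set {set P}};
  output : {set P * P} -> {set {set P}} -> mixed_graph P
}.

Definition run (P : finType) (A : nonadaptive_algorithm P)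
    (r : repository P) : mixed_graph P :=
  output A (known r) [set I in queries A (known r) | successful r I].

Definition solves_full_learning (P : finType) (A : nonadaptive_algorithm P)
    (class : repository P -> Prop) : Prop :=
  forall r, class r -> describes (run A r) r.

Definition makes_at_least (P : finType) (A : nonadaptive_algorithm P)
    (class : repository P -> Prop) (m : nat) : Prop :=
  exists2 r, class r & m <= #|queries A (known r)|.

Definition no_defects_conflicts (P : finType) (r : repository P) : Prop :=
  defects r = set0 /\ conflicts r = set0.

Definition at_most_one_unknown (P : finType) (r : repository P) : Prop :=
  no_defects_conflicts r /\ #|unknown r| <= 1.

(* Without defects and conflicts, describing r amounts to knowing its
   reachability relation; the two lemmas give both directions. *)
Section Reachability.
Variable P : finType.
Implicit Types (r s : repository P) (G : mixed_graph P).

Lemma mem_scc r p : p \in scc r p.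
Proof. by rewrite inE /reaches connect0. Qed.

Lemma connect_sccE r p q :
  connect (edge_rel (scc_dependencies r)) (scc r p) (scc r q) = reaches r p q.
Proof.
apply/idP/idP => [|/connectP[s]].
  case/connectP=> s; elim: s p => [|B s IHs] p /=.
    move=> _ eqpq; have := mem_scc r q.
    by rewrite eqpq inE => /andP[].
  case/andP=> /imsetP[[x y] exy [eqpx ->]] /(IHs y) yq /yq {}yq.
  have: p \in scc r x by rewrite -eqpx mem_scc.
  rewrite inE => /andP[_ px]; apply: connect_trans px _.
  exact: connect_trans (connect1 exy) yq.
elim: s p => [|x s IHs] p /=; first by move=> _ ->; exact: connect0.
case/andP=> epx /IHs xq /xq; apply: connect_trans.
by apply: connect1; apply/imsetP; exists (p, x).
Qed.

Lemma describes_reaches r s G :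
  describes G r -> describes G s -> reaches r =2 reaches s.
Proof.
move=> [Vr _ _ Er] [Vs _ _ Es].
have eq_scc p : scc r p = scc s p.
  have : scc r p \in sccs s by rewrite -Vs Vr imset_f.
  case/imsetP=> x _ eqx; rewrite eqx.
  have: p \in scc s x by rewrite -eqx mem_scc.
  rewrite inE => /andP[xp px]; apply/setP=> y; rewrite !inE.
  apply/andP/andP=> -[a b]; split.
  - exact: connect_trans px a.
  - exact: connect_trans b xp.
  - exact: connect_trans xp a.
  - exact: connect_trans b px.
by move=> p q; rewrite -!connect_sccE -Er Es !eq_scc.
Qed.

Lemma reaches_describes r s G :
  no_defects_conflicts r -> no_defects_conflicts s ->
  reaches r =2 reaches s -> describes G r -> describes G s.
Proof.
move=> [Dr Cr] [Ds Cs] eqR [V M E A].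
have eq_scc : scc r =1 scc s by move=> p; apply/setP=> q; rewrite !inE !eqR.
have eq_sccs : sccs r = sccs s by exact: eq_imset.
split; rewrite ?V ?M ?E /scc_conflicts ?eq_sccs ?Dr ?Ds ?Cr ?Cs ?imset0 //.
move=> X Y; rewrite A.
have sub (a b : repository P) X' Y' : scc a =1 scc b -> reaches a =2 reaches b ->
    connect (edge_rel (scc_dependencies a)) X' Y' ->
    connect (edge_rel (scc_dependencies b)) X' Y'.
  move=> eab rab; apply: connect_sub => x y /imsetP[[u v] euv [-> ->]].
  by rewrite /= !eab (connect_sccE b u v) -rab; exact: connect1.
by apply/idP/idP; apply: sub => // x y; rewrite eqR.
Qed.

End Reachability.

(* Main.v *)
(** Let the known dependencies form a total order, each package depending on
    all smaller ones.  The successful installations are then the initial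
    segments.  One unknown dependency of a package x on its immediate successor
    changes only the status of the initial segment ending at x, but it changes
    the reachability relation.  Hence each of the n - 1 nonempty proper initial
    segments must be queried. *)

Require Import Defs.
From mathcomp Require Import all_boot.

Set Implicit Arguments.
Unset Strict Implicit.
Unset Printing Implicit Defensive.

Lemma successful_reaches (P : finType) (r : repository P) (I : {set P}) x y :
  successful r I -> reaches r x y -> x \in I -> y \in I.
Proof.
case/and3P=> _ /forall_inP closedI _ /connectP[s].
elim: s x => [x _ -> // | z s IHs x /= /andP[xz path_s] last_s Ix].
by apply: IHs path_s last_s _; apply: (implyP (closedI _ xz)).
Qed.

(** [run] sees a repository only through [known] and the answers to its queries, so [r] and [s]
    receive the same graph, and one graph cannot describe two different reachability relations. *)
Lemma full_learning_separates (P : finType) (A : nonadaptive_algorithm P)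
    (class : repository P -> Prop) (r s : repository P) :
  solves_full_learning A class -> class r -> class s -> known r = known s ->
  {in queries A (known r), successful r =1 successful s} ->
  reaches r =2 reaches s.
Proof.
move=> solveA class_r class_s known_rs eq_answers.
apply: describes_reaches (solveA r class_r) _.
suff ->: run A r = run A s by exact: solveA.
rewrite /run -known_rs; congr (output A _ _); apply/setP=> I; rewrite !inE.
by case: (boolP (I \in _)) => //= /eq_answers.
Qed.

Section Chain.
Variable P : finType.
Implicit Types (U : {set P * P}) (I : {set P}) (x y : P).

(** All comparable pairs are taken, not only consecutive ones: the relation is then transitive, and
    a closed walk would collapse to a loop. *)
Definition chain : {set P * P} := [set e | enum_rank e.2 < enum_rank e.1].

Lemma chain_acyclic : acyclic chain.
Proof.
case=> //= x c; have chain_trans : transitive (edge_rel chain).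
  by move=> y x' z; rewrite /edge_rel !inE /= => yx zy; apply: ltn_trans yx.
move=> /(order_path_min chain_trans).
by rewrite all_rcons /edge_rel inE /= ltnn.
Qed.

Lemma no_conflict_pairs (c : {set P}) : c \in set0 -> #|c| = 2.
Proof. by rewrite inE. Qed.

Definition chain_repository U : repository P :=
  Repository U set0 chain_acyclic no_conflict_pairs.

Lemma chain_successfulP U I :
  reflect ((forall x y, enum_rank y < enum_rank x -> x \in I -> y \in I) /\
           (forall x y, (x, y) \in U -> x \in I -> y \in I))
          (successful (chain_repository U) I).
Proof.
apply: (iffP and3P) => [[_ /forall_inP closedI _] | [closedK closedU]].
  by split=> x y xy; apply/implyP/(closedI (x, y)); rewrite !inE /= xy ?orbT.
split; first by rewrite setI0.
  apply/forall_inP=> -[x y]; rewrite !inE /= => /orP[xy | xy]; apply/implyP.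
    exact: closedK.
  exact: closedU.
by apply/forall_inP=> c; rewrite inE.
Qed.

(** The bound is inclusive, so the nonempty proper segments are those with [k < #|P| - 1]. *)
Definition initial_segment (k : nat) : {set P} := [set x | enum_rank x <= k].

Lemma initial_segment_successful k :
  successful (chain_repository set0) (initial_segment k).
Proof.
apply/chain_successfulP; split=> x y; rewrite !inE //.
by move=> /ltnW; apply: leq_trans.
Qed.

(** The extra edge rules out only sets containing [x] but not [y]; closure under [chain] leaves a
    single such set, the segment ending at [x]. *)
Lemma successor_edge_successful x y I :
    enum_rank y = (enum_rank x).+1 :> nat ->
    I != initial_segment (enum_rank x) ->
  successful (chain_repository set0) I =
    successful (chain_repository [set (x, y)]) I.
Proof.
move=> rank_y neqI; apply/chain_successfulP/chain_successfulP => -[closedK _].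
  split=> // _ _ /set1P[-> ->] Ix; apply: contraNT neqI => nIy.
  apply/eqP/setP=> z; rewrite inE; case: (ltngtP (enum_rank z) (enum_rank x)).
  - by move=> zx; apply: closedK zx Ix.
  (* A [z] ranked above [x] has at least the rank of [y], so [z] in [I] would force [y] into [I]. *)
  - move=> xz; apply: contraNF nIy => Iz.
    move: xz; rewrite -rank_y leq_eqVlt => /orP[/eqP/val_inj/enum_rank_inj -> //|].
    by move=> yz; apply: closedK yz Iz.
  - by move=> /val_inj/enum_rank_inj->.
by split=> // ? ?; rewrite inE.
Qed.

Lemma initial_segment_queried (A : nonadaptive_algorithm P)
    (class : repository P -> Prop) k :
    (forall r, at_most_one_unknown r -> class r) ->
    solves_full_learning A class -> k.+1 < #|P| ->
  initial_segment k \in queries A chain.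
Proof.
move=> sub_class solveA lt_k1.
pose x := enum_val (Ordinal (ltnW lt_k1)); pose y := enum_val (Ordinal lt_k1).
have rank_x : enum_rank x = k :> nat by rewrite enum_valK.
have rank_y : enum_rank y = k.+1 :> nat by rewrite enum_valK.
apply: contraT => not_queried.
have eq_reaches : reaches (chain_repository set0) =2
                  reaches (chain_repository [set (x, y)]).
  apply: full_learning_separates solveA _ _ _ _ => //.
  - by apply: sub_class; split; rewrite ?cards0.
  - by apply: sub_class; split; rewrite ?cards1.
  move=> I queriedI; apply: successor_edge_successful.
    by rewrite rank_x rank_y.
  by rewrite rank_x; apply: contraNneq not_queried => <-.
(* The segment is successful without the extra edge and separates [x] from [y], so this reachability
   is absurd. *)
have: reaches (chain_repository set0) x y.
  by rewrite eq_reaches; apply: connect1; rewrite /edge_rel !inE eqxx orbT.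
move/(successful_reaches (initial_segment_successful k)).
by rewrite !inE rank_x rank_y leqnn ltnn => /(_ isT).
Qed.

(** The package of rank [k] lies in the segment of [l] only if [k <= l], so equal segments bound
    each index by the other. *)
Lemma initial_segment_inj :
  injective (fun k : 'I_(#|P| - 1) => initial_segment k).
Proof.
have lt_card (k : 'I_(#|P| - 1)) : k < #|P| by apply: leq_trans (leq_subr 1 _).
have le_index (k l : 'I_(#|P| - 1)) :
    initial_segment k = initial_segment l -> k <= l.
  move/setP/(_ (enum_val (Ordinal (lt_card k)))).
  by rewrite !inE enum_valK /= leqnn => <-.
by move=> k l eq_kl; apply/val_inj/eqP; rewrite eqn_leq !le_index.
Qed.

(** Leaving [class] general lets one argument serve both settings; the costly input is the chain
    with no unknown dependency. *)
Lemma full_learning_lower_bound (A : nonadaptive_algorithm P)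
    (class : repository P -> Prop) :
    (forall r, at_most_one_unknown r -> class r) ->
  solves_full_learning A class -> makes_at_least A class (#|P| - 1).
Proof.
move=> sub_class solveA; exists (chain_repository set0).
  by apply: sub_class; split; rewrite ?cards0.
rewrite -[leqLHS]card_ord -(card_imset _ initial_segment_inj).
apply/subset_leq_card/subsetP=> _ /imsetP[k _ ->].
by apply: initial_segment_queried sub_class solveA _; rewrite -[k.+1]add1n -ltn_subRL.
Qed.

End Chain.

Theorem theorem11 (n : nat) (n_ge1 : 1 <= n) (P : finType) (cardP : #|P| = n)
    (A : nonadaptive_algorithm P) :
  (solves_full_learning A (@no_defects_conflicts P) ->
     makes_at_least A (@no_defects_conflicts P) (n - 1)) /\
  (solves_full_learning A (@at_most_one_unknown P) ->
     makes_at_least A (@at_most_one_unknown P) (n - 1)).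
Proof.
rewrite -cardP; split; apply: full_learning_lower_bound => // r.
by case.
Qed.
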